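(* Let $\delta\ge3$ and let $\overrightarrow{\mathcal K}$ be a Ramsey class whose members are either all ordered metric spaces with distances in $\{1,\dots,\delta-1\}$, or all ordered metric spaces with distances in $\{1,\dots,\delta-1\}$ equipped with a unary predicate $B$ determining the bipartition. Then the class $\overrightarrow{\mathcal K}^\ominus=\{\overrightarrow{\mathbf M}^\ominus:\overrightarrow{\mathbf M}\in\overrightarrow{\mathcal K}\}$ of all antipodal expansions of members of $\overrightarrow{\mathcal K}$ is Ramsey.
   Context: For $\mathbf M=(M,d)$ with distances at most $\delta-1$, its antipodal extension is $\mathbf M^\ominus=(M\times\{0,1\},d')$ with $d'((u,i),(v,i))=d(u,v)$ and $d'((u,i),(v,1-i))=\delta-d(u,v)$ for $u,v\in M$, $i\in\{0,1\}$ (so $d'((u,0),(u,1))=\delta$). For an ordered space $\overrightarrow{\mathbf M}=(M,d,\le)$, $\overrightarrow{\mathbf M}^\ominus$ is $\mathbf M^\ominus$ with order $(u,i)\le(v,j)$ iff $i<j$, or $i=j$ and $u\le v$. For an ordered bipartite space $(M,d,\le,B)$, where $B$ is a unary predicate such that $d(u,v)$ is even iff $u,v$ are both in $B$ or both outside $B$, the antipodal extension additionally has the predicate $B^\ominus$ with $(v,0)\in B^\ominus$ iff $v\in B$, and $(v,1)\in B^\ominus$ iff $v\in B$ when $\delta$ is even, iff $v\notin B$ when $\delta$ is odd. A class $\mathcal C$ is Ramsey if for all $\mathbf A,\mathbf B\in\mathcal C$ and $k\ge1$ there is $\mathbf C\in\mathcal C$ such that for every $k$-colouring of the substructures of $\mathbf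 C$ isomorphic to $\mathbf A$ some substructure of $\mathbf C$ isomorphic to $\mathbf B$ has all its copies of $\mathbf A$ of one colour. *)

(* Defs.v *)
From mathcomp Require Import all_boot.
From mathcomp Require Import boolp classical_sets.

Set Implicit Arguments.
Unset Strict Implicit.
Unset Printing Implicit Defensive.

Local Open Scope classical_set_scope.

Variant language := Ordered | OrderedBipartite.

Definition unary_symbol (L : language) : Type :=
  match L with Ordered => void | OrderedBipartite => unit end.

(* No axiom is imposed on the structures themselves: the antipodal extension of
   a metric space need not satisfy the triangle inequality, so Ramsey classes
   are classes of arbitrary structures in the language.  For [L = Ordered],
   [upred] is a function out of [void] and carries no data. *)
Record ostruct (L : language) := OStruct {
  carrier :> Type;
  dist : carrier -> carrier -> nat;
  ole : rel carrier;
  upred : unary_symbol L -> pred carrier }.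

Arguments dist {L o} u v.
Arguments ole {L o} u v.
Arguments upred {L o} p u.

Section Structures.
Variable L : language.
Implicit Types M N A B C : ostruct L.

Definition isomorphism M N (f : M -> N) : Prop :=
  [/\ bijective f,
      forall u v, dist (f u) (f v) = dist u v,
      forall u v, ole (f u) (f v) = ole u v
    & forall p u, upred p (f u) = upred p u].

Definition isomorphic M N : Prop := exists f : M -> N, isomorphism f.

Definition substructure M (S : set M) : ostruct L :=
  @OStruct L (set_type S)
    (fun u v => dist (val u) (val v))
    (fun u v => ole (val u) (val v))
    (fun p u => upred p (val u)).

Definition copy A C (S : set C) : Prop := isomorphic A (substructure S).

Definition Ramsey (K : ostruct L -> Prop) : Prop :=
  forall A B, K A -> K B -> forall k : nat, 1 <= k ->
  exists2 C, K C &
    forall chi : {S : set C | copy A S} -> 'I_k,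
    exists2 S : set C, copy B S &
      exists c : 'I_k, forall S' : {S : set C | copy A S},
        sval S' `<=` S -> chi S' = c.

(* An ordered metric space with distances in {1, ..., delta - 1}; the last
   clause, which is vacuous for [L = Ordered], says that the unary predicate
   determines the bipartition. *)
Record ordered_metric_space (delta : nat) M : Prop := {
  dist_eq0 : forall u v : M, dist u v = 0 <-> u = v;
  dist_sym : forall u v : M, dist u v = dist v u;
  dist_triangle : forall u v w : M, dist u w <= dist u v + dist v w;
  dist_bound : forall u v : M, dist u v <= delta - 1;
  ole_refl : reflexive (@ole L M);
  ole_anti : antisymmetric (@ole L M);
  ole_trans : transitive (@ole L M);
  ole_total : total (@ole L M);
  bipartition : forall (p : unary_symbol L) (u v : M),
    ~~ odd (dist u v) <-> upred p u = upred p v }.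

Definition antipodal (delta : nat) M : ostruct L :=
  @OStruct L (M * bool)%type
    (fun x y => if x.2 == y.2 then dist x.1 y.1 else delta - dist x.1 y.1)
    (fun x y => (x.2 < y.2) || (x.2 == y.2) && ole x.1 y.1)
    (fun p x => if x.2 && odd delta then ~~ upred p x.1 else upred p x.1).

Definition antipodal_class (delta : nat) (K : ostruct L -> Prop) :
    ostruct L -> Prop :=
  fun N => exists2 M, K M & N = antipodal delta M.

End Structures.

(* Main.v *)
(** In the antipodal extension of a space with distances below [delta], the
    points at distance [delta] from a point are exactly its antipode, and the
    order puts level 0 before level 1.  An embedding of one extension into
    another therefore preserves the levels and is induced by an embedding of
    the base spaces.  Hence [S |-> S x {0,1}] is an inclusion-preserving
    bijection from the copies of [A] in [C] onto the copies of the extension of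
    [A] in the extension of [C], and the Ramsey property carries over. *)
Require Import Defs.
From mathcomp Require Import all_boot.
From mathcomp Require Import boolp classical_sets.

Set Implicit Arguments.
Unset Strict Implicit.
Unset Printing Implicit Defensive.

Local Open Scope classical_set_scope.

Section Embeddings.
Variable L : language.
Implicit Types A C : ostruct L.

Definition embedding A C (e : A -> C) : Prop :=
  [/\ injective e,
      forall u v, dist (e u) (e v) = dist u v,
      forall u v, ole (e u) (e v) = ole u v
    & forall p u, upred p (e u) = upred p u].

(** Trades isomorphisms onto a subset type for maps into [C] itself, so that copies are ranges that
    can be lifted or projected. *)
Lemma copyP A C (S : set C) :
  copy A S <-> exists2 e : A -> C, embedding e & S = range e.
Proof.
split=> [[f [bij_f fd fo fp]]|[e [einj ed eo ep] ->]].
  have [g fK gK] := bij_f.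
  exists (fun u => val (f u)).
    by split=> // u v /val_inj; apply: (can_inj fK).
  apply/seteqP; split=> [x /mem_set Sx|_ [u _ <-]]; last exact: set_mem (valP _).
  by exists (g (exist _ x Sx)); rewrite ?gK.
have re u : e u \in range e by apply: mem_set; exists u.
exists (fun u => exist _ (e u) (re u)); split=> //.
have inv (x : set_type (range e)) : {u | e u = val x}.
  by apply: cid; case: (set_mem (valP x)) => u _ eu; exists u.
by exists (fun x => sval (inv x)) => [u|x];
  [apply: einj|apply: val_inj => /=]; rewrite (svalP (inv _)).
Qed.

End Embeddings.

Section Antipodal.
Variables (L : language) (delta : nat).
Implicit Types A C : ostruct L.

Definition double C (S : set C) : set (antipodal delta C) :=
  [set x | S x.1].

Lemma copy_double A C (S : set C) :
  copy A S -> copy (antipodal delta A) (double S).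
Proof.
case/copyP=> e [einj ed eo ep] ->; apply/copyP.
exists (fun x : antipodal delta A => (e x.1, x.2) : antipodal delta C).
  split=> [[u i] [v j] [/einj -> ->]|x y|x y|p x] //=.
  - by rewrite ed.
  - by rewrite eo.
  - by rewrite ep.
apply/seteqP; split=> [[w i] [u _ /= euw]|_ [[u i] _ <-]]; last by exists u.
by exists (u, i); rewrite //= euw.
Qed.

Section Levels.
Variables A C : ostruct L.
Hypotheses (delta_gt0 : 0 < delta) (mA : ordered_metric_space delta A).
Hypothesis mC : ordered_metric_space delta C.

(** On one level distances stay below [delta]; across levels [delta - d] equals [delta] only for
    [d = 0]. *)
Lemma antipodal_dist_delta (x y : antipodal delta C) :
  dist x y = delta -> x.1 = y.1 /\ x.2 != y.2.
Proof.
have lt_d : dist x.1 y.1 < delta.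
  by rewrite -(prednK delta_gt0) ltnS -subn1 (dist_bound mC).
rewrite /=; case: eqP => _ dxy; first by rewrite dxy ltnn in lt_d.
split=> //; apply/(dist_eq0 mC)/eqP.
by rewrite -(eqn_add2l delta) addn0 -{1}dxy subnK // ltnW.
Qed.

Lemma antipodal_embedding (e : antipodal delta A -> antipodal delta C) :
  embedding e -> forall u i, e (u, i) = ((e (u, false)).1, i).
Proof.
case=> _ ed eo _ u.
have [e1 e2] : (e (u, false)).1 = (e (u, true)).1 /\
               (e (u, false)).2 != (e (u, true)).2.
  apply: antipodal_dist_delta.
  by rewrite ed /= (proj2 (dist_eq0 mA u u) erefl) subn0.
(* Since [(u, false)] lies below [(u, true)], order preservation rules out a swap of levels. *)
move: e1 e2 (eo (u, false) (u, true)) => + + + [].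
all: case: (e (u, false)) (e (u, true)) => x i [y j] /= -> + +.
all: by case: i j => [] [].
Qed.

(** The images of level 0 determine the whole embedding, so their projection is the base copy. *)
Lemma copy_antipodal (T : set (antipodal delta C)) :
  copy (antipodal delta A) T -> exists2 S : set C, copy A S & T = double S.
Proof.
case/copyP=> e he ->; have el := antipodal_embedding he.
have [einj ed eo ep] := he.
pose h u := (e (u, false)).1.
exists (range h).
  apply/copyP; exists h => //; split=> [u v huv|u v|u v|p u].
  - suff [] : (u, false) = (v, false) by [].
    by apply: einj; rewrite el [RHS]el -/(h u) huv.
  (* Level 0 carries the structure of the base space unchanged: the predicate can flip only on level
     1. *)
  - by have := ed (u, false) (v, false); rewrite el [e (v, _)]el.
  - by have := eo (u, false) (v, false); rewrite el [e (v, _)]el.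
  - by have := ep p (u, false); rewrite el.
apply/seteqP; split=> [_ [[u i] _ <-]|[w i] [u _ /= huw]].
  by rewrite el; exists u.
by exists (u, i); rewrite // el -/(h u) huw.
Qed.

End Levels.
End Antipodal.

Theorem theorem7p4 (delta : nat) (L : language) (K : ostruct L -> Prop)
    (hdelta : 3 <= delta)
    (hK : forall M : ostruct L, K M -> ordered_metric_space delta M)
    (hR : Ramsey K) :
  Ramsey (antipodal_class delta K).
Proof.
move=> _ _ [A KA ->] [B KB ->] k k_gt0.
have [C KC ramC] := hR A B KA KB k k_gt0.
exists (antipodal delta C); first by exists C.
move=> chi.
(* Each copy of [A] inherits the colour of its double. *)
pose chi0 (S : {S : set C | copy A S}) : 'I_k :=
  chi (exist _ _ (copy_double delta (svalP S))).
have [S cS [c chi0c]] := ramC chi0.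
exists (double S); first exact: copy_double.
exists c => -[T cT] /= sTS.
have [S0 cS0 eT] :=
  copy_antipodal (ltn_trans (isT : 0 < 2) hdelta) (hK _ KA) (hK _ KC) cT.
rewrite -(chi0c (exist _ S0 cS0)); last first.
  by move=> w /= S0w; apply: (sTS (w, false)); rewrite eT.
(* The two coloured copies have equal underlying sets; only the proofs of being a copy differ. *)
by congr (chi _); apply: eq_exist.
Qed.
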